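(* The identity string field $|\mathcal{I}\rangle$ of the $\star$-algebra, i.e. the state whose BPZ conjugate is $\langle\mathcal{I}|=\langle 0|U_{f_{\mathcal{I}}}$ with $f_{\mathcal{I}}(z)=\dfrac{z}{1-z^2}$, is given by $$|\mathcal{I}\rangle=\left(\prod_{n=2}^{\infty}\exp\left\{-\frac{2}{2^n}L_{-2^n}\right\}\right)e^{L_{-2}}|0\rangle=\cdots\exp\left(-\frac{2}{2^3}L_{-2^3}\right)\exp\left(-\frac{2}{2^2}L_{-2^2}\right)\exp(L_{-2})|0\rangle,$$ where in the infinite product the factors with Virasoro operators of higher index stand to the left of those with lower index.
   Context: $L_n$ ($n\in\mathbb{Z}$) are the total (matter plus ghost) Virasoro operators, with total central charge zero, so $[L_m,L_n]=(m-n)L_{m+n}$. $|0\rangle$ is the $SL(2,\mathbb{R})$-invariant vacuum, $L_n|0\rangle=0$ for $n\ge -1$. States are understood as formal infinite sums of their components in the $L_0$-eigenspaces; each $L_{-n}$ raises the $L_0$-eigenvalue by $n$, so each component of the infinite expressions below receives finitely many contributions. For a power series $f(z)=z+O(z^2)$, let $v(z)=\sum_{n\ge1}v_nz^{n+1}$ be the unique formal vector field coefficient such that $\exp\{v(z)\partial_z\}\,z=f(z)$, and set $U_f=\exp\left(\sum_{n\ge1}v_nL_n\right)$. BPZ conjugation replaces $\langle 0|$ by $|0\rangle$, each $L_n$ by $(-1)^nL_{-n}$, and reverses the order of products of Virasoro operators. Thus, for $f_{\mathcal{I}}(z)=z/(1-z^2)$ with associated coefficients $v_n$ (which vanish for odd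 $n$), $|\mathcal{I}\rangle=\exp\left(\sum_{n\ge1}(-1)^nv_nL_{-n}\right)|0\rangle=e^{L_{-2}-\frac12L_{-4}+\frac12L_{-6}-\frac{7}{12}L_{-8}+\cdots}|0\rangle$. *)

(* Defs.v *)
From HB Require Import structures.
From mathcomp Require Import all_boot all_order all_algebra.
From mathcomp Require Import boolp classical_sets functions cardinality fsbigop.
From mathcomp Require Import zify.
Set Implicit Arguments.
Unset Strict Implicit.
Unset Printing Implicit Defensive.
Import Order.TTheory GRing.Theory Num.Theory.
Local Open Scope ring_scope.

Section FormalVectorFields.
Variable K : fieldType.

(** Formal power series in [z]: [f m] is the coefficient of [z ^ m]. *)
Definition fps := nat -> K.

Definition fpsX : fps := fun m => (m == 1%N)%:R.
Definition fps_mul (f g : fps) : fps :=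
  fun m => \sum_(i < m.+1) f i * g (m - i)%N.
Definition fps_deriv (f : fps) : fps := fun m => m.+1%:R * f m.+1.

(** [v(z) = \sum_(n >= 1) v_n z ^ n.+1]; the value [v 0] is not used. *)
Definition vfield (v : nat -> K) : fps :=
  fun m => if (2 <= m)%N then v m.-1 else 0.

(** The derivation [v(z) d/dz]. *)
Definition vderiv (v : nat -> K) (g : fps) : fps :=
  fps_mul (vfield v) (fps_deriv g).

(** The series [exp(v(z) d/dz) z].  As [v(z) = O(z^2)], the series
    [(v(z) d/dz)^j z] is [O(z ^ j.+1)], so the terms with [j >= m] do not
    contribute to the coefficient of [z ^ m] ([vderiv_order]). *)
Definition exp_vfield (v : nat -> K) : fps :=
  fun m => \sum_(j < m.+1) (j`!)%:R^-1 * iter j (vderiv v) fpsX m.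

(** [z / (1 - z ^ 2) = z + z ^ 3 + z ^ 5 + ...], see [fps_identityE]. *)
Definition fps_identity : fps := fun m => (odd m)%:R.

Lemma fps_identityE :
  fps_mul (fun m => (m == 0%N)%:R - (m == 2%N)%:R) fps_identity =1 fpsX.
Proof.
rewrite /fps_mul /fps_identity /fpsX => -[|[|m]].
- by rewrite big_ord1 mulr0.
- by rewrite !big_ord_recl big_ord0 /= !subr0 mul1r mul0r !addr0.
rewrite 3!big_ord_recl big1 /= => [|i _].
  by rewrite /bump /= !subr0 sub0r mul0r mul1r add0r addr0 mulN1r subn2 /=
     negbK subrr.
by rewrite /bump /= subr0 mul0r.
Qed.

Lemma vderiv_order (v : nat -> K) j m :
  (m <= j)%N -> iter j (vderiv v) fpsX m = 0.
Proof.
elim: j m => [|j IH] m; first by rewrite leqn0 => /eqP ->.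
move=> le_mj /=; rewrite /vderiv /fps_mul big1 // => i _.
rewrite /vfield /fps_deriv; case: ifP => [i2|]; last by rewrite mul0r.
by rewrite IH ?mulr0 //; have := ltn_ord i; lia.
Qed.

Lemma vderiv_local (v w : nat -> K) n :
  (forall k, (0 < k < n)%N -> v k = w k) ->
  forall j m, (m <= n)%N -> iter j (vderiv v) fpsX m = iter j (vderiv w) fpsX m.
Proof.
move=> vw; elim=> [//|j IH] m le_mn /=; apply: eq_bigr => i _.
rewrite /vfield /fps_deriv; case: ifP => [i2|]; last by rewrite !mul0r.
by rewrite IH ?vw //; have := ltn_ord i; lia.
Qed.

Let rem_coef v n := exp_vfield v n.+2 - v n.+1.

Lemma rem_coef_local (v w : nat -> K) n :
  (forall k, (0 < k < n.+1)%N -> v k = w k) -> rem_coef v n = rem_coef w n.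
Proof.
move=> vw.
have lin u : iter 1 (vderiv u) fpsX n.+2 = u n.+1.
  rewrite /= /vderiv /fps_mul big_ord_recr /= /vfield /fps_deriv /fpsX /=.
  rewrite subnn /= !mulr1 big1 ?add0r // => i _.
  have lti := ltn_ord i.
  by rewrite (_ : (n.+2 - i).+1 == 1%N = false) ?mulr0 //; lia.
have split u : exp_vfield u n.+2 = u n.+1
    + \sum_(j < n.+1) (j.+2`!)%:R^-1 * iter j.+2 (vderiv u) fpsX n.+2.
  rewrite /exp_vfield big_ord_recl [X in X + _]/= /fpsX /= mulr0 add0r.
  rewrite big_ord_recl; congr (_ + _).
  by rewrite -[RHS]lin /bump /= invr1 mul1r.
rewrite /rem_coef !split !(addrC (_ n.+1)) !addrK.
apply: eq_bigr => j _; congr (_ * _).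
rewrite ![iter j.+2 _ _]iterS; apply: eq_bigr => i _.
rewrite /vfield /fps_deriv; case: ifP => [i2|]; last by rewrite !mul0r.
have lti := ltn_ord i.
have [i_max|i_small] := eqVneq (i : nat) n.+2.
  by rewrite i_max subnn !vderiv_order // !mulr0.
have ltin : (i < n.+2)%N by lia.
by rewrite vw ?(@vderiv_local v w n.+1) //; lia.
Qed.

Lemma exp_vfieldE (v : nat -> K) n : exp_vfield v n.+2 = v n.+1 + rem_coef v n.
Proof. by rewrite /rem_coef addrC subrK. Qed.

(** Every [f(z) = z + O(z^2)] is [exp(v(z) d/dz) z] for some [v]... *)
Lemma exp_vfield_exists (f : fps) :
  f 0%N = 0 -> f 1%N = 1 -> exists v, exp_vfield v =1 f.
Proof.
move=> f0 f1.
pose fix s n : nat -> K := if n is n'.+1 then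
  fun k => if k == n'.+1 then f n'.+2 - rem_coef (s n') n' else s n' k
  else fun=> 0.
have s_stable d n k : (k <= n)%N -> s (n + d)%N k = s n k.
  move=> le_kn; elim: d => [|d IH]; first by rewrite addn0.
  by rewrite addnS /= ifF ?IH //; lia.
exists (fun n => s n n) => -[|[|n]].
- by rewrite /exp_vfield big_ord1 /= /fpsX mulr0 f0.
- rewrite /exp_vfield big_ord_recr big_ord1 (@vderiv_order _ 1 1) //=.
  by rewrite /fpsX mulr0 invr1 mulr1 addr0 f1.
rewrite exp_vfieldE (@rem_coef_local _ (s n)) /= ?eqxx ?subrK // => k lt_kn.
by have := s_stable (n - k)%N k k (leqnn k); rewrite subnKC //; lia.
Qed.

(** ... and the coefficients [v_n], [n >= 1], are unique. *)
Lemma exp_vfield_unique (v w : nat -> K) :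
  exp_vfield v =1 exp_vfield w -> forall n, (0 < n)%N -> v n = w n.
Proof.
move=> vw n; elim/ltn_ind: n => -[//|n] IH _.
have := vw n.+2; rewrite !exp_vfieldE (@rem_coef_local v w) => [/addIr //|].
by move=> k /andP[k0 kn]; apply: IH.
Qed.

End FormalVectorFields.

Section VirasoroSeries.
Variable K : fieldType.

(** Formal series in products of the symbols [L_n], [n : int]: the value of
    [A] at the word [n_1 ... n_k] is the coefficient of [L_{n_1} ... L_{n_k}]. *)
Definition vseries := seq int -> K.

Definition vs_one : vseries := fun w => (w == [::])%:R.

Definition vs_mul (A B : vseries) : vseries :=
  fun w => \sum_(i < (size w).+1) A (take i w) * B (drop i w).

(** Exponential of a series [A] without constant term; the coefficients of
    [A ^ j] then vanish on words of length less than [j]. *)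
Definition vs_exp (A : vseries) : vseries :=
  fun w => \sum_(j < (size w).+1) (j`!)%:R^-1 * iter j (vs_mul A) vs_one w.

(** The single term [c L_n]. *)
Definition vs_L (c : K) (n : int) : vseries :=
  fun w => if w == [:: n] then c else 0.

(** [\sum_(n >= 1) v_n L_n]. *)
Definition vs_pos (v : nat -> K) : vseries :=
  fun w => if w is [:: Posz n.+1] then v n.+1 else 0.

(** [U_f], where [v] is such that [exp_vfield v =1 f]. *)
Definition U_op (v : nat -> K) : vseries := vs_exp (vs_pos v).

(** BPZ conjugation [L_{n_1} ... L_{n_k} |-> (-1)^(n_1 + ... + n_k)
    L_{-n_k} ... L_{-n_1}], extended linearly: it is an involution on words,
    whence the coefficient below. The conjugate of the bra [<0|A] is the ket
    [(bpz A)|0>]. *)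
Definition bpz (A : vseries) : vseries :=
  fun w => (\prod_(n <- w) (-1) ^ n) * A (rev (map -%R w)).

(** [exp(-2/2^N L_{-2^N}) ... exp(-2/2^2 L_{-2^2}) exp(L_{-2})]: [foldl]
    multiplies the successive factors [n = 2, ..., N] on the left. *)
Definition identity_product (N : nat) : vseries :=
  foldl (fun B n => vs_mul (vs_exp (vs_L (- (2 / 2 ^+ n)) (- (2 ^ n)%N%:Z))) B)
        (vs_exp (vs_L 1 (- 2%:Z)))
        (index_iota 2 N.+1).

(** The series [A] only involves the [L_n] with [P n]. *)
Definition on_words (P : pred int) (A : vseries) : Prop :=
  forall w, A w != 0 -> all P w.

Lemma on_words_mul P A B :
  on_words P A -> on_words P B -> on_words P (vs_mul A B).
Proof.
move=> PA PB w; apply: contraR => nPw; apply/eqP; apply: big1 => i _.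
have [->|/PA PAi] := eqVneq (A (take i w)) 0; first by rewrite mul0r.
have [->|/PB PBi] := eqVneq (B (drop i w)) 0; first by rewrite mulr0.
by case/negP: nPw; rewrite -(cat_take_drop i w) all_cat PAi.
Qed.

Lemma on_words_exp P A : on_words P A -> on_words P (vs_exp A).
Proof.
move=> PA w; apply: contraR => nPw; apply/eqP; apply: big1 => j _.
suff PAj : on_words P (iter j (vs_mul A) vs_one).
  have [->|/PAj] := eqVneq (iter j (vs_mul A) vs_one w) 0.
    by rewrite mulr0.
  by rewrite (negPf nPw).
elim: (j : nat) => [|k IH] /=; last exact: on_words_mul.
by move=> {nPw} [|n u]; rewrite /vs_one /= ?eqxx.
Qed.

Lemma on_words_L (P : pred int) c n : P n -> on_words P (vs_L c n).
Proof.
by move=> Pn w; rewrite /vs_L; case: ifP => [/eqP ->|]; rewrite /= ?Pn ?eqxx.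
Qed.

Lemma on_words_bpz_U v : on_words (fun n => n < 0) (bpz (U_op v)).
Proof.
have PU : on_words (fun n => 0 < n) (U_op v).
  by apply: on_words_exp => -[|[[|n]|n] [|a w]] //=; rewrite eqxx.
move=> w; rewrite /bpz mulf_eq0 negb_or => /andP[_ /PU].
by rewrite all_rev all_map; apply: sub_all => n /=; rewrite oppr_gt0.
Qed.

Lemma on_words_identity_product N :
  on_words (fun n => n < 0) (identity_product N).
Proof.
rewrite /identity_product.
have : on_words (fun n => n < 0) (vs_exp (vs_L 1 (- 2%:Z))).
  exact/on_words_exp/on_words_L.
elim: (index_iota 2 N.+1) (vs_exp _) => [//|n s IH] A PA /=.
apply: IH; apply: on_words_mul => //; apply/on_words_exp/on_words_L.
by rewrite oppr_lt0 ltz_nat expn_gt0.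
Qed.

End VirasoroSeries.

Section States.
Variables (K : fieldType) (V : lmodType K).

Definition virasoro_c0 (L : int -> {linear V -> V}) : Prop :=
  forall (m n : int) (x : V),
    L m (L n x) - L n (L m x) = (m - n)%:~R *: L (m + n) x.

Definition sl2_vacuum (L : int -> {linear V -> V}) (vac : V) : Prop :=
  forall n : int, -1 <= n -> L n vac = 0.

(** A formal infinite sum of [L_0]-eigenvectors: [psi h] is the component of
    eigenvalue [h]. *)
Definition formal_state := int -> V.

Definition word_act (L : int -> {linear V -> V}) (w : seq int) (x : V) : V :=
  foldr (fun n y => L n y) x w.

(** The state [A|0>]. The word [w] raises the [L_0]-eigenvalue of [|0>], which
    is 0, by minus the sum of its letters ([ket_L0]). The sum is over all words
    that contribute to the component; it is a finite sum as soon as [A] only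
    involves [L_n] with [n < 0] ([ket_finite]), otherwise it may be the
    default value 0. *)
Definition ket (L : int -> {linear V -> V}) (vac : V) (A : vseries K) :
    formal_state :=
  fun h => \sum_(w \in [set w : seq int | - (\sum_(n <- w) n) = h])
             A w *: word_act L w vac.

(** Convergence of formal states: each component is eventually constant. *)
Definition formal_cvg (u : nat -> formal_state) (psi : formal_state) : Prop :=
  forall h : int, exists N0 : nat, forall N : nat, (N0 <= N)%N -> u N h = psi h.

Lemma ket_finite (L : int -> {linear V -> V}) (vac : V) (A : vseries K)
    (h : int) :
  on_words (fun n => n < 0) A ->
  finite_set ([set w : seq int | - (\sum_(n <- w) n) = h]
              `&` [set w | A w *: word_act L w vac != 0])%classic.
Proof.
move=> Aneg.
pose m := `|h|%N.
pose code (t : {k : 'I_m.+1 & k.-tuple 'I_m.+1}) : seq int :=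
  [seq - (i : nat)%:Z | i : 'I_m.+1 <- tagged t].
apply: (@sub_finite_set _ _ (range code)); last first.
  by apply: finite_image; exact: finite_finset.
move=> w /= [hw Aw].
have {Aw}/Aneg negw : A w != 0 by apply: contraNneq Aw => ->; rewrite scale0r.
have size_w s : all (fun n : int => n < 0) s ->
    (size s)%:Z <= - (\sum_(n <- s) n).
  elim: s => [|a s IH] /=; first by rewrite big_nil.
  case/andP=> a0 /IH; rewrite big_cons.
  by move: (\sum_(n <- s) n : int) => S; lia.
have letter s : all (fun n : int => n < 0) s ->
    forall n, n \in s -> - n <= - (\sum_(n <- s) n).
  elim: s => [//|a s IH] /= /andP[a0 negs] n; rewrite inE big_cons.
  move: (IH negs n) (size_w _ negs) => {}IH.
  move: (\sum_(n <- s) n : int) IH => S IH szs.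
  by case/orP=> [/eqP ->|/IH]; lia.
have szw : (size w < m.+1)%N by have := size_w _ negw; rewrite hw /m; lia.
pose s := [seq inord `|n|%N : 'I_m.+1 | n <- w].
have szs : size s == Ordinal szw by rewrite size_map.
exists (Tagged (fun k : 'I_m.+1 => k.-tuple 'I_m.+1) (Tuple szs)) => //.
rewrite /code /= /s -map_comp -[RHS]map_id; apply/eq_in_map => n nw /=.
have n0 : n < 0 by have /allP := negw; apply.
by have := letter _ negw n nw; rewrite hw => ?; rewrite inordK /m; lia.
Qed.

Lemma ket_L0 (L : int -> {linear V -> V}) (vac : V) (A : vseries K)
    (h : int) :
  virasoro_c0 L -> sl2_vacuum L vac ->
  L 0 (ket L vac A h) = h%:~R *: ket L vac A h.
Proof.
move=> HL Hvac; rewrite /ket; rewrite big_seq_cond.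
elim/big_ind : _ => [|x y Hx Hy|w].
- by rewrite linear0 scaler0.
- by rewrite linearD Hx Hy scalerDr.
rewrite andbT => ws; have hw : - (\sum_(n <- w) n) = h.
  by case: finite_supportP ws => // X XP _ _ /XP.
rewrite linearZ /= scalerA mulrC -scalerA; congr (_ *: _).
rewrite -{}hw {ws}; elim: w => [|a w IH] /=.
  by rewrite big_nil oppr0 scale0r Hvac.
have := HL 0 a (word_act L w vac); rewrite !add0r IH linearZ /=.
move/eqP; rewrite subr_eq => /eqP ->; rewrite -scalerDl -rmorphD.
by rewrite big_cons opprD.
Qed.

End States.

(* Main.v *)
Require Import Defs.
From HB Require Import structures.
From mathcomp Require Import all_boot all_order all_algebra.
From mathcomp Require Import boolp classical_sets functions cardinality fsbigop.
From mathcomp Require Import zify ring.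
Set Implicit Arguments.
Unset Strict Implicit.
Unset Printing Implicit Defensive.
Import Order.TTheory GRing.Theory Num.Theory.
Local Open Scope ring_scope.

(** Under BPZ conjugation [(-1)^n L_{-n}] obeys the commutation relations of
    [z^(n+1) d/dz], so the string field and the series [f] are both of the form
    [exp(v) w] in a graded module over these vector fields. With [D] the degree
    operator, [D exp(v) = x exp(v) + exp(v) D], where the vector field [x] (the
    logarithmic derivative of [v]) depends on [v] alone. In power series this
    reads [z f' - f = x f'], which gives [x = 2 z^3 / (1 + z^2)] for [z / (1 - z^2)].

    Let [Q_p] be the exponential with logarithmic derivative
    [-2 z^(p+1) / (1 - z^p)]. It satisfies
    [Q_2p z^(p+1) d/dz = z^(p+1) / (1 - z^2p) d/dz Q_2p], whence
    [Q_p = Q_2p exp(-2/p z^(p+1) d/dz)]: compare logarithmic derivatives. In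
    the same way [x = 2 z^3 / (1 - z^4) - 2 z^5 / (1 - z^4)] gives
    [exp(v) = Q_4 exp(z^3 d/dz)], and [Q_2p] is the identity modulo degree [2p]. In characteristic 0 each of these operator identities
    follows, degree by degree, from the commutator with [D]. *)

(** * Convolution sums over fixed index ranges *)

Section Convolution.
Variable V : nmodType.

Lemma big_pick (N k : nat) (F : nat -> V) :
  \sum_(e < N) (if k == e then F e else 0) = if (k < N)%N then F k else 0.
Proof.
case: ifP => kN; last first.
  by rewrite big1 // => e _; rewrite ifF //; have := ltn_ord e; lia.
rewrite (bigD1 (Ordinal kN)) //= eqxx big1 ?addr0 // => e.
by rewrite -val_eqE /= eq_sym => /negPf ->.
Qed.

(** With indices in a fixed box and the constraint moved into the summand, nested sums can be
    exchanged freely. *)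
Lemma conv_wide (N h : nat) (F : nat -> nat -> V) : (h < N)%N ->
  \sum_(i < h.+1) F i (h - i)%N =
  \sum_(i < N) \sum_(j < N) (if (i + j == h)%N then F i j else 0).
Proof.
move=> hN; rewrite -(big_mkord xpredT (fun i => F i (h - i)%N)).
rewrite (big_nat_widen _ _ N) // big_mkcond /= big_mkord.
apply: eq_bigr => i _; have iN := ltn_ord i.
rewrite (_ : (if _ then _ else _) =
   if (i <= h)%N then (if (h - i < N)%N then F i (h - i)%N else 0) else 0).
  rewrite -(big_pick N (h - i) (F i)); case: ifP => ih; last first.
    by rewrite big1 // => j _; rewrite ifF //; lia.
  apply: eq_bigr => j _; congr (if _ then _ else _).
  by apply/eqP/eqP; lia.
by rewrite ltnS; case: ifP => // ih; rewrite (_ : (h - i < N)%N) //; lia.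
Qed.

Lemma sum_triangle (J : nat) (f : nat -> nat -> V) :
  (forall k l, (J <= k + l.+1)%N -> f k l = 0) ->
  \sum_(j < J) \sum_(k < j) f k (j.-1 - k)%N = \sum_(k < J) \sum_(l < J) f k l.
Proof.
move=> f0.
transitivity (\sum_(j < J) \sum_(k < J) \sum_(l < J)
   (if (k + l).+1 == j :> nat then f k l else 0)).
  apply: eq_bigr => -[[|j] jJ] _ /=.
    by rewrite big_ord0 big1 // => k _; rewrite big1.
  by rewrite (@conv_wide J) //; lia.
rewrite exchange_big; apply: eq_bigr => k _.
rewrite exchange_big; apply: eq_bigr => l _.
rewrite (@big_pick J (k + l).+1 (fun=> f k l)).
by case: ifP => // kl; rewrite f0 //; lia.
Qed.

End Convolution.

(** * Bracket and logarithmic derivative of formal vector fields *)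

Section WittBracket.
Variable K : fieldType.
Implicit Types a b : nat -> K.

(** A sequence [a] stands for the field with terms [a n z^(n+1) d/dz], and
    [[z^(i+1) d/dz, z^(j+1) d/dz] = (j - i) z^(i+j+1) d/dz]. *)
Definition wbracket a b : nat -> K :=
  fun l => \sum_(i < l.+1) a i * b (l - i)%N * ((l - i)%:R - i%:R).

Definition weuler a : nat -> K := fun n => n%:R * a n.

Fixpoint wad a k : nat -> K :=
  if k is k'.+1 then wbracket a (wad a k') else weuler a.

(** The operator [(exp(ad a) - 1) / ad a] applied to [weuler a], the bracket of [z d/dz] with [a].
    For [a 0 = 0] the terms with [k >= n] vanish in degree [n], by [wad_order]. *)
Definition dlog a : nat -> K := fun n => \sum_(k < n) (k.+1`!)%:R^-1 * wad a k n.

Lemma wad_order a k n : a 0%N = 0 -> (n <= k)%N -> wad a k n = 0.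
Proof.
move=> a0; elim: k n => [|k IH] n.
  by rewrite leqn0 => /eqP ->; rewrite /= /weuler mul0r.
move=> nk; rewrite /= /wbracket big1 // => -[[|i] ilt] _ /=.
  by rewrite a0 !mul0r.
by rewrite IH ?mulr0 ?mul0r //; lia.
Qed.

Lemma dlogE a J n : a 0%N = 0 -> (n <= J)%N ->
  dlog a n = \sum_(k < J) (k.+1`!)%:R^-1 * wad a k n.
Proof.
move=> a0 nJ; rewrite /dlog.
rewrite (big_ord_widen J (fun k => (k.+1`!)%:R^-1 * wad a k n)) //.
rewrite big_mkcond; apply: eq_bigr => k _; case: ifP => // kn.
by rewrite wad_order ?mulr0 //; lia.
Qed.

Lemma dlog0 a : dlog a 0 = 0.
Proof. by rewrite /dlog big_ord0. Qed.

End WittBracket.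

(** * Exponentials of vector fields on a graded module *)

Section GradedModule.
Variables (K : fieldType) (V : lmodType K).
(* [T n d] is the action of [z^(n+1) d/dz] on the component of degree [d]. *)
Variable T : nat -> nat -> {linear V -> V}.
Hypothesis T0 : forall d x, T 0 d x = d%:R *: x.
Hypothesis TT : forall m n d x,
  T m (n + d) (T n d x) - T n (m + d) (T m d x) = (n%:R - m%:R) *: T (m + n) d x.

Local Notation W := (nat -> V).
Implicit Types (a b : nat -> K) (psi : W).

Definition op a psi : W :=
  fun h => \sum_(i < h.+1) a i *: T i (h - i) (psi (h - i)%N).

Lemma op_is_linear a : linear (op a).
Proof.
move=> c phi psi; apply/funext => h; rewrite !fctE /op scaler_sumr -big_split /=.
apply: eq_bigr => i _; rewrite linearD linearZ scalerDr !scalerA.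
by rewrite [in X in X + _]mulrC.
Qed.
HB.instance Definition _ a :=
  GRing.isLinear.Build K W W *:%R (op a) (op_is_linear a).

Lemma opD a phi psi : op a (phi + psi) = op a phi + op a psi.
Proof. exact: linearD. Qed.

Lemma opZ a c psi : op a (c *: psi) = c *: op a psi.
Proof. exact: linearZ. Qed.

Lemma op_sum a (n : nat) (F : 'I_n -> W) :
  op a (\sum_(i < n) F i) = \sum_(i < n) op a (F i).
Proof. exact: linear_sum. Qed.

Lemma op_op a b psi N h : (h < N)%N ->
  op a (op b psi) h = \sum_(i < N) \sum_(j < N) \sum_(d < N)
    (if (i + (j + d) == h)%N
     then (a i * b j) *: T i (j + d) (T j d (psi d)) else 0).
Proof.
move=> hN; rewrite /op.
rewrite (@conv_wide _ N h (fun i e => a i *: T i e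
  (\sum_(j < e.+1) b j *: T j (e - j) (psi (e - j)%N)))) //.
apply: eq_bigr => i _.
transitivity (\sum_(e < N) \sum_(j < N) \sum_(d < N)
   (if (j + d == e)%N then
     (if (i + e == h)%N then (a i * b j) *: T i e (T j d (psi d)) else 0) else 0)).
  apply: eq_bigr => e _; case: ifP => ieh; last first.
    by rewrite big1 // => j _; rewrite big1 // => d _; case: ifP.
  rewrite (@conv_wide _ N e (fun j d => b j *: T j d (psi d))) //.
  rewrite linear_sum scaler_sumr; apply: eq_bigr => j _.
  rewrite linear_sum scaler_sumr; apply: eq_bigr => d _.
  by case: ifP => _; rewrite ?linear0 ?scaler0 // linearZ scalerA.
rewrite exchange_big; apply: eq_bigr => j _.
rewrite exchange_big; apply: eq_bigr => d _.
rewrite (@big_pick _ N (j + d) (fun e => if (i + e == h)%N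
   then (a i * b j) *: T i e (T j d (psi d)) else 0)).
by case: ifP => // jdN; rewrite ifF //; apply/eqP; lia.
Qed.

(** Expanded over a common box, the two products match term by term in [i], [j], [d], and [TT]
    applies to each pair. *)
Lemma op_bracket a b psi :
  op a (op b psi) - op b (op a psi) = op (wbracket a b) psi.
Proof.
apply/funext => h; rewrite !fctE.
have hh := ltnSn h.
rewrite (op_op a b psi hh) (op_op b a psi hh) [X in _ - X]exchange_big /=.
rewrite -sumrB; symmetry.
rewrite {1}/op (@conv_wide _ h.+1 h (fun e d => wbracket a b e *: T e d (psi d))) //.
transitivity (\sum_(e < h.+1) \sum_(d < h.+1) \sum_(i < h.+1) \sum_(j < h.+1)
  (if (i + j == e)%N then (if (e + d == h)%N then
     (a i * b j * (j%:R - i%:R)) *: T e d (psi d) else 0) else 0)).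
  apply: eq_bigr => e _; apply: eq_bigr => d _; case: ifP => edh; last first.
    by rewrite big1 // => j _; rewrite big1 // => i _; case: ifP.
  rewrite /wbracket (@conv_wide _ h.+1 e (fun i j => a i * b j * (j%:R - i%:R))) //.
  rewrite scaler_suml; apply: eq_bigr => i _.
  rewrite scaler_suml; apply: eq_bigr => j _.
  by case: ifP => // _; rewrite scale0r.
under eq_bigr do rewrite exchange_big /=.
rewrite exchange_big; apply: eq_bigr => i _.
under eq_bigr do rewrite exchange_big /=.
rewrite exchange_big -sumrB; apply: eq_bigr => j _.
rewrite exchange_big -sumrB; apply: eq_bigr => d _.
rewrite (@big_pick _ h.+1 (i + j) (fun e => if (e + d == h)%N
   then (a i * b j * (j%:R - i%:R)) *: T e d (psi d) else 0)).
rewrite (_ : (j + (i + d) = i + (j + d))%N); last by lia.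
case: ifP => ijN; last by rewrite !ifF ?subrr //; apply/eqP; lia.
rewrite -addnA; case: ifP => // _; last by rewrite subrr.
by rewrite (mulrC (b j)) -scalerBr TT scalerA.
Qed.

Definition degree psi : W := fun h => h%:R *: psi h.

(** By [T0] the degree operator is the action of [z d/dz], so its commutators become instances of
    [op_bracket]. *)
Lemma degreeE psi : degree psi = op (fun n => (n == 0%N)%:R) psi.
Proof.
apply/funext => h; rewrite /op big_ord_recl big1 => [|i _]; last by rewrite scale0r.
by rewrite addr0 scale1r subn0 T0.
Qed.

Lemma degree_op a psi : degree (op a psi) = op a (degree psi) + op (weuler a) psi.
Proof.
rewrite !degreeE; apply/eqP; rewrite addrC -subr_eq op_bracket; apply/eqP.
congr (op _ _); apply/funext => l; rewrite /wbracket big_ord_recl big1 ?addr0 /=.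
  by rewrite mul1r subn0 subr0 mulrC.
by move=> i _; rewrite !mul0r.
Qed.

Lemma degree_is_linear : linear degree.
Proof.
move=> c phi psi; apply/funext => h.
by rewrite !fctE /degree scalerDr !scalerA mulrC.
Qed.
HB.instance Definition _ :=
  GRing.isLinear.Build K W W *:%R degree degree_is_linear.

Lemma op_order a psi n m :
  (forall i, (i < n)%N -> a i = 0) -> (forall k, (k < m)%N -> psi k = 0) ->
  forall h, (h < n + m)%N -> op a psi h = 0.
Proof.
move=> an psim h hnm; rewrite /op big1 // => i _.
have [lt_in|le_ni] := ltnP i n; first by rewrite an ?scale0r.
have ltih := ltn_ord i; by rewrite psim ?linear0 ?scaler0 //; lia.
Qed.

Lemma iter_op_order a psi m j : a 0%N = 0 -> (forall k, (k < m)%N -> psi k = 0) ->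
  forall h, (h < j + m)%N -> iter j (op a) psi h = 0.
Proof.
move=> a0 psim; elim: j => [|j IH] h /=; first exact: psim.
by apply: (@op_order a _ 1 (j + m)) => // -[].
Qed.

Lemma iter_op_is_linear a j : linear (iter j (op a)).
Proof. by move=> c phi psi; elim: j => [|j IH] //=; rewrite IH linearP. Qed.

(** When [a 0 = 0], the [j]-th power raises degrees by at least [j], so terms with [j > h] do not
    reach degree [h]. *)
Definition exp_op a psi : W :=
  fun h => \sum_(j < h.+1) (j`!)%:R^-1 *: iter j (op a) psi h.

Lemma exp_opE a psi J h : a 0%N = 0 -> (h < J)%N ->
  exp_op a psi h = (\sum_(j < J) (j`!)%:R^-1 *: iter j (op a) psi) h.
Proof.
move=> a0 hJ; rewrite fct_sumE /exp_op.
rewrite (big_ord_widen J (fun j => (j`!)%:R^-1 *: iter j (op a) psi h)) //.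
rewrite big_mkcond /=; apply: eq_bigr => j _; case: ifP => // hj.
by rewrite fctE (@iter_op_order _ _ 0) ?scaler0 //; lia.
Qed.

Lemma exp_op_is_linear a : linear (exp_op a).
Proof.
move=> c phi psi; apply/funext => h; rewrite !fctE /exp_op scaler_sumr -big_split /=.
apply: eq_bigr => j _; rewrite iter_op_is_linear !fctE scalerDr !scalerA.
by rewrite [in X in X + _]mulrC.
Qed.
HB.instance Definition _ a :=
  GRing.isLinear.Build K W W *:%R (exp_op a) (exp_op_is_linear a).

Lemma exp_op_lead a psi h : a 0%N = 0 -> (forall k, (k < h)%N -> psi k = 0) ->
  exp_op a psi h = psi h.
Proof.
move=> a0 psih; rewrite /exp_op big_ord_recl invr1 scale1r big1 ?addr0 // => j _.
by rewrite (@iter_op_order _ _ h) ?scaler0 //= /bump /=; lia.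
Qed.

Lemma op_local a phi psi h :
  (forall k, (k <= h)%N -> phi k = psi k) -> op a phi h = op a psi h.
Proof. by move=> eqp; apply: eq_bigr => i _; rewrite eqp // leq_subr. Qed.

(** By induction on [j]: moving [op a] past [op (wad a k)] costs [op (wad a k.+1)], and the
    coefficients add up by Pascal's rule. *)
Lemma degree_iter_op a psi j :
  degree (iter j (op a) psi) = iter j (op a) (degree psi) +
  \sum_(k < j) 'C(j, k.+1)%:R *: op (wad a k) (iter (j.-1 - k) (op a) psi).
Proof.
elim: j => [|j IH]; first by rewrite big_ord0 addr0.
rewrite iterS degree_op IH linearD -addrA; congr (_ + _).
rewrite linear_sum /=.
under [RHS]eq_bigr do rewrite binS natrD scalerDl.
rewrite big_split /= big_ord_recr /= bin_small // scale0r addr0.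
rewrite [X in _ = _ + X]big_ord_recl /= bin0 scale1r subn0.
rewrite [X in _ = _ + X]addrC addrA; congr (_ + _).
rewrite -big_split /=; apply: eq_bigr => k _; rewrite linearZ /= /bump /= -scalerDr.
congr (_ *: _); rewrite add1n -op_bracket addrC.
rewrite (_ : (j - k.+1 = j.-1 - k)%N); last by lia.
rewrite (_ : (j - k = (j.-1 - k).+1)%N); last by have := ltn_ord k; lia.
by rewrite iterS subrK.
Qed.


Hypothesis charK : [pchar K] =i pred0.

Lemma natr_neq0 n : (0 < n)%N -> n%:R != 0 :> K.
Proof. by move=> n0; rewrite (pcharf0P _).1 // -lt0n. Qed.

(** Since [C(j, k+1) / j! = 1 / ((k+1)! (j-k-1)!)], the double sum given by [degree_iter_op] is the
    product of the series of [dlog a] and the exponential. *)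
Theorem degree_exp a psi : a 0%N = 0 ->
  degree (exp_op a psi) = op (dlog a) (exp_op a psi) + exp_op a (degree psi).
Proof.
move=> a0; apply/funext => h; rewrite fctE.
set J := h.+1.
transitivity (degree (\sum_(j < J) (j`!)%:R^-1 *: iter j (op a) psi) h).
  by rewrite /degree (@exp_opE _ _ J).
rewrite linear_sum.
under eq_bigr do rewrite linearZ /= degree_iter_op scalerDr.
rewrite big_split /= fctE addrC (@exp_opE a (degree psi) J) //; congr (_ + _).
rewrite (@op_local _ _ (\sum_(l < J) (l`!)%:R^-1 *: iter l (op a) psi)); last first.
  by move=> k kh; rewrite (@exp_opE _ _ J).
pose f k l := ((k.+1`!)%:R^-1 * (l`!)%:R^-1) *: op (wad a k) (iter l (op a) psi) h.
transitivity (\sum_(k < J) \sum_(l < J) f k l); last first.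
  transitivity (\sum_(k < J) (k.+1`!)%:R^-1 *:
     op (wad a k) (\sum_(l < J) (l`!)%:R^-1 *: iter l (op a) psi) h).
    apply: eq_bigr => k _; rewrite op_sum fct_sumE scaler_sumr.
    by apply: eq_bigr => l _; rewrite opZ scalrfctE scalerA.
  under eq_bigr do rewrite /op scaler_sumr.
  rewrite exchange_big; apply: eq_bigr => i _.
  rewrite (@dlogE _ a J) // 1?ltnW // scaler_suml; apply: eq_bigr => k _.
  by rewrite scalerA.
(* Terms with [k + l + 1 >= J] have order above [h], so triangle and square have the same sum. *)
rewrite -sum_triangle => [|k l klJ]; last first.
  rewrite /f (@op_order _ _ k.+1 l) ?scaler0 //; last by lia.
    by move=> i ik; apply: wad_order.
  by move=> i il; apply: (@iter_op_order _ _ 0) => //; lia.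
rewrite fct_sumE; apply: eq_bigr => j _; rewrite fctE fct_sumE scaler_sumr.
apply: eq_bigr => k _; rewrite fctE scalerA /f; congr (_ *: _).
have kj := ltn_ord k; rewrite (_ : (j.-1 - k = j - k.+1)%N); last by lia.
have := congr1 (fun n => n%:R : K) (bin_fact kj); rewrite !natrM => <-.
by rewrite invfM mulrAC mulVf ?mul1r ?invfM // natr_neq0 // bin_gt0.
Qed.

Definition homog d (x : V) : W := fun k => if k == d then x else 0.

Lemma degree_homog d x : degree (homog d x) = d%:R *: homog d x.
Proof.
apply/funext => k; rewrite fctE /degree /homog.
by case: eqP => [->|_]; rewrite ?scaler0.
Qed.

(* On the component of degree [h] of the image of a vector of degree [d], the
   hypothesis reads [(h - c - d) * _ = 0] once the lower components vanish. *)
Lemma degree_vanish (R : {linear W -> W}) (y : nat -> K) (c m : nat) :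
  y 0%N = 0 ->
  (forall psi h, (forall k, (k + c < h)%N -> psi k = 0) -> R psi h = 0) ->
  (forall psi h, (h < m)%N -> degree (R psi) h =
     c%:R *: R psi h + op y (R psi) h + R (degree psi) h) ->
  forall psi h, (h < m)%N -> R psi h = 0.
Proof.
move=> y0 Rord RD psi h; elim/ltn_ind: h psi => h IH psi hm.
have hom0 d x : R (homog d x) h = 0.
  (* Up to degree [d + c] the order hypothesis suffices; beyond it [h - c - d] is a positive
     integer, invertible in characteristic 0. *)
  have [le_h|lt_h] := leqP h (d + c).
    by apply: Rord => k kch; rewrite /homog ifF //; lia.
  have := RD (homog d x) h hm.
  rewrite degree_homog linearZ /= scalrfctE /degree {1}/op big1 => [|[[|i] ih] _ /=].
  - rewrite addr0 -scalerDl => /eqP; rewrite -subr_eq0 -scalerBl -natrD.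
    rewrite -natrB; last by lia.
    rewrite scaler_eq0 => /orP[|/eqP //].
    by rewrite (negPf (natr_neq0 _)) //; lia.
  - by rewrite y0 scale0r.
  - by rewrite IH ?linear0 ?scaler0 //; lia.
(* [phi] cuts [psi] off above degree [h]; the order hypothesis disposes of the difference. *)
pose phi := \sum_(d < h.+1) homog d (psi d).
have phiE k : (k <= h)%N -> phi k = psi k.
  move=> kh; rewrite /phi fct_sumE /homog.
  by rewrite (@big_pick _ h.+1 k psi) ltnS kh.
rewrite -[psi](subrK phi) linearD fctE [X in X + _]Rord => [|k kch]; last first.
  by rewrite !fctE phiE ?subrr //; lia.
by rewrite add0r /phi linear_sum fct_sumE big1.
Qed.

End GradedModule.

(** * Power series as a graded module *)

Section PowerSeriesModule.
Variable K : fieldType.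
Hypothesis charK : [pchar K] =i pred0.

(** As [z^(n+1) d/dz] sends [z^d] to [d z^(n+d)], the scalar is the same for all [n]. *)
Definition fps_action (n d : nat) : {linear K^o -> K^o} := *:%R (d%:R : K).

Lemma fps_action0 d x : fps_action 0 d x = d%:R *: x.
Proof. by []. Qed.

Lemma fps_action_witt m n d x :
  fps_action m (n + d) (fps_action n d x) - fps_action n (m + d) (fps_action m d x)
  = (n%:R - m%:R) *: fps_action (m + n) d x.
Proof. by rewrite /fps_action /= -scalerBl !natrD; congr (_ *: _); ring. Qed.

Lemma op_fpsE (a f : nat -> K) h :
  op fps_action a f h = \sum_(i < h.+1) a i * ((h - i)%:R * f (h - i)%N).
Proof. by []. Qed.

Lemma vderivE (v : nat -> K) (g : nat -> K) :
  v 0%N = 0 -> vderiv v g = op fps_action v g.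
Proof.
move=> v0; apply/funext => -[|m]; rewrite /vderiv /fps_mul /op.
  by rewrite !big_ord1 /= v0 /GRing.scale /= !mul0r.
rewrite [LHS]big_ord_recl mul0r add0r [RHS]big_ord_recr /= subnn.
rewrite [X in _ = _ + X](_ : _ = 0) ?addr0; last first.
  by rewrite /GRing.scale /= mul0r mulr0.
apply: eq_bigr => i _; rewrite /vfield /fps_deriv /bump /= add1n ltnS subSS.
rewrite (subSn (ltn_ord i : (i <= m)%N)).
by case: posnP => [->|//]; rewrite v0 /GRing.scale /= !mul0r.
Qed.

Lemma exp_vfieldE_op (v : nat -> K) :
  v 0%N = 0 -> exp_vfield v = exp_op fps_action v (fpsX K).
Proof.
move=> v0; apply/funext => h; apply: eq_bigr => j _; congr (_ * iter j _ _ h).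
by apply/funext => g; exact: vderivE.
Qed.

(** The last hypothesis is [z f' = f + y f']. By [degree_exp] and [D z = z], [dlog v] solves the
    same equation, whose solution is unique. *)
Lemma vfield_dlog (v y f : nat -> K) : v 0%N = 0 -> exp_vfield v =1 f ->
  y 0%N = 0 -> f 0%N = 0 -> f 1%N = 1 ->
  (forall h, h%:R * f h = f h + op fps_action y f h) -> dlog v = y.
Proof.
move=> v0 /funext vf y0 f0 f1 yf.
have degX : degree (fpsX K : nat -> K^o) = fpsX K.
  apply/funext => -[|[|h]]; rewrite /degree /fpsX /=.
  - by rewrite scale0r.
  - by rewrite scale1r.
  - by rewrite scaler0.
have := degree_exp fps_action0 fps_action_witt charK (fpsX K : nat -> K^o) v0.
rewrite degX -exp_vfieldE_op // vf => /funeqP Df.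
have eqop h : op fps_action (dlog v) f h = op fps_action y f h.
  apply: (@addrI _ (f h)); rewrite -yf; have := Df h.
  by rewrite fctE addrC => <-.
apply/funext; elim/ltn_ind => -[_|n IH]; first by rewrite dlog0.
(* In degree [n + 2] the highest unknown is the coefficient [n + 1], multiplied by [f 1 = 1]; the
   term [i = n + 2] carries the factor 0. *)
have := eqop n.+2; rewrite !op_fpsE big_ord_recr [in RHS]big_ord_recr /=.
rewrite subnn !mul0r !mulr0 !addr0.
rewrite big_ord_recr [in RHS]big_ord_recr /= subSnn f1 !mulr1.
rewrite (eq_bigr (fun i : 'I_n.+1 => y i * ((n.+2 - i)%:R * f (n.+2 - i)%N))).
  by move/addrI.
by move=> i _; rewrite IH.
Qed.

(** The equation [z f' - f = y f'] is solved for [f] recursively, dividing by [k - 1] in degree [k];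
    then [f] is an exponential by [exp_vfield_exists]. *)
Lemma vfield_dlog_exists (y : nat -> K) :
  y 0%N = 0 -> exists2 v, v 0%N = 0 & dlog v = y.
Proof.
move=> y0.
(* [s n] holds the coefficients of [f] up to degree [n + 1], starting from [f = z]. *)
pose fix s n : nat -> K := if n is n'.+1 then
  fun k => if k == n.+1 then n%:R^-1 * op fps_action y (s n') n.+1 else s n' k
  else fun k => (k == 1%N)%:R.
pose f k := s k.-1 k.
have s0 n : s n 0%N = 0 by elim: n => //= n ->.
have s1 n : s n 1%N = 1 by elim: n => //= n ->.
have s_stable n k : (k <= n.+1)%N -> s n k = f k.
  elim: n => [|n IH].
    by case: k => [|[]] //; rewrite /f !s0.
  rewrite /= leq_eqVlt => /orP[/eqP ->|lt_kn]; first by rewrite /f /= eqxx.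
  by rewrite ifF ?IH //; lia.
have [|//|v vf] := @exp_vfield_exists _ f; first by rewrite /f s0.
pose v' n := if n == 0%N then 0 else v n.
have v'f : exp_vfield v' =1 f.
  have eqv : vfield v' = vfield v by apply/funext => -[|[|n]].
  by move=> h; rewrite -vf /exp_vfield /vderiv eqv.
exists v' => //; apply: (vfield_dlog (f := f)) => //.
move=> [|[|h]].
- by rewrite op_fpsE /f s0 mulr0 big_ord1 y0 mul0r addr0.
- by rewrite mul1r op_fpsE !big_ord_recl big_ord0 y0 /= mul0r {3}/f s0 !mulr0 !addr0.
rewrite {1 2}/f /= eqxx -[h.+2]addn1 natrD mulrDl mul1r addrC; congr (_ + _).
rewrite mulrA mulfV ?mul1r; last by rewrite natr_neq0.
rewrite addn1 !op_fpsE; apply: eq_bigr => -[[|i] ih] _; first by rewrite y0 !mul0r.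
by rewrite s_stable //=; lia.
Qed.

End PowerSeriesModule.

(** * Identities behind the passage from [p] to [2p] *)

Section Doubling.
Variable K : fieldType.

Definition pulse (c : K) (p : nat) : nat -> K := fun n => if n == p then c else 0.

(* Coefficients of [z^(p+1) / (1 - z^(2p))] and of [-2 z^(p+1) / (1 - z^p)],
   the latter being [z - g / g'] for [g = z (1 + z^p)^(-2/p)]. *)
Definition odd_multiples (p : nat) : nat -> K :=
  fun n => if (p %| n)%N && odd (n %/ p) then 1 else 0.

Definition tail_dlog (p : nat) : nat -> K :=
  fun n => if (0 < n)%N && (p %| n)%N then - 2 else 0.

(** [weuler] only rescales a single term, so every further bracket vanishes. *)
Lemma dlog_pulse c p : (0 < p)%N -> dlog (pulse c p) = pulse (p%:R * c) p.
Proof.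
move=> p0; have wad0 k n : wad (pulse c p) k.+1 n = 0.
  elim: k n => [|k IH] n.
    rewrite /= /wbracket big1 // => i _; rewrite /weuler /pulse.
    case: eqP => [->|_]; last by rewrite !mul0r.
    by case: eqP => [->|_]; rewrite ?mulr0 ?subrr ?mulr0 ?mul0r.
  rewrite -[LHS]/(wbracket (pulse c p) (wad (pulse c p) k.+1) n) /wbracket.
  by rewrite big1 // => i _; rewrite IH mulr0 mul0r.
apply/funext => -[|n]; first by rewrite dlog0 /pulse ifF //; lia.
rewrite /dlog big_ord_recl big1 => [|i _]; last by rewrite wad0 mulr0.
rewrite invr1 mul1r addr0 /= /weuler /pulse.
by case: eqP => [->|]; rewrite ?mulr0.
Qed.

Lemma tail_dlog_split p : (0 < p)%N ->
  tail_dlog p = (fun n => - 2 * odd_multiples p n + tail_dlog (2 * p) n).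
Proof.
move=> p0; apply/funext => n; rewrite /tail_dlog /odd_multiples.
have [/dvdnP[k ->]|np] := boolP (p %| n)%N; last first.
  rewrite !andbF /= mulr0 add0r ifF //; apply/negP => /andP[_ /dvdnP[k nk]].
  by case/negP: np; rewrite nk mulnA dvdn_mull.
rewrite dvdn_pmul2r // mulnK // dvdn2 muln_gt0 p0 !andbT /=.
case: k => [|k]; first by rewrite /= mulr0 addr0.
by case: (odd k.+1); rewrite /= ?mulr1 ?mulr0 ?addr0 ?add0r.
Qed.

(** The infinitesimal form of [exp_op_intertwine]. For [l = (2s+1)p] it reduces to an arithmetic
    sum: [p - 2 (s l - 2p s(s+1)) = l]. *)
Lemma odd_multiples_bracket p l : (0 < p)%N ->
  p%:R * odd_multiples p l + wbracket (tail_dlog (2 * p)) (odd_multiples p) l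
  = l%:R * odd_multiples p l.
Proof.
move=> p0; set Y := tail_dlog _; set Z := odd_multiples p.
(* [Z] has period [2p], so it factors out of the bracket with [Y], which is supported on multiples
   of [2p]. *)
have Zshift k i : (k <= i)%N -> (2 * p %| k)%N -> Z (i - k)%N = Z i.
  move=> ki /dvdnP[j kE]; rewrite /Z /odd_multiples.
  have kj : k = (j * 2 * p)%N by rewrite kE mulnA.
  have pk : (p %| k)%N by rewrite kj dvdn_mull.
  rewrite dvdn_subl //; case: (boolP (p %| i)%N) => //= /dvdnP[m im].
  rewrite im kj -mulnBl !mulnK // oddB ?oddM ?andbF ?addbF //.
  by move: ki; rewrite im kj leq_pmul2r.
have YZ : wbracket Y Z l = Z l * \sum_(i < l.+1) Y i * (l%:R - 2 * i%:R).
  rewrite /wbracket mulr_sumr; apply: eq_bigr => i _; rewrite /Y /tail_dlog.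
  have il : (i <= l)%N by have := ltn_ord i.
  case: ifP => [/andP[_ pi]|_]; last by rewrite !mul0r mulr0.
  by rewrite Zshift // natrB //; ring.
rewrite {}YZ [Z l]/(odd_multiples p l) /odd_multiples; case: ifP => [|_]; last first.
  by rewrite !mulr0 mul0r addr0.
case/andP=> /dvdnP[n ln]; rewrite {1}ln mulnK // => oddn.
pose s := n./2; have {ln oddn} ls : l = ((2 * s).+1 * p)%N.
  by rewrite ln /s mul2n -[in LHS](odd_double_half n) oddn.
rewrite !mulr1 mul1r.
have -> : \sum_(i < l.+1) Y i * (l%:R - 2 * i%:R) =
    \sum_(k < s.+1) Y (k * (2 * p))%N * (l%:R - 2 * (k * (2 * p))%:R).
  transitivity (\sum_(i < l.+1) \sum_(k < s.+1)
     (if (k * (2 * p) == i)%N then Y i * (l%:R - 2 * i%:R) else 0)).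
    apply: eq_bigr => i _; rewrite {1}/Y /tail_dlog.
    have [/dvdnP[j ij]|np] := boolP (2 * p %| i)%N; last first.
      rewrite andbF mul0r big1 // => k _; rewrite ifF //.
      by apply/negP => /eqP ki; rewrite -ki dvdn_mull in np.
    rewrite andbT; have js : (j < s.+1)%N.
      have : (j * (2 * p) <= (2 * s).+1 * p)%N by rewrite -ij -ls -ltnS.
      by rewrite mulnCA mulnA leq_pmul2r //; lia.
    rewrite (bigD1 (Ordinal js)) //= -ij eqxx big1 ?addr0 => [|k].
      by rewrite /Y /tail_dlog ij dvdn_mull // andbT.
    rewrite -val_eqE /= => kj; rewrite ifF // ij eqn_pmul2r ?muln_gt0 //.
    exact: negPf kj.
  rewrite exchange_big; apply: eq_bigr => k _.
  rewrite (@big_pick _ l.+1 _ (fun i => Y i * (l%:R - 2 * i%:R))) ifT //.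
  rewrite ltnS ls mulnCA mulnA leq_pmul2r //; have := ltn_ord k; lia.
(* The term [k = 0] drops out because [tail_dlog] vanishes at 0. *)
rewrite big_ord_recl {1}/Y /tail_dlog /= mul0r add0r.
have -> t : \sum_(k < t) Y (bump 0 k * (2 * p))%N
     * (l%:R - 2 * (bump 0 k * (2 * p))%:R)
   = - 2 * (t%:R * l%:R - 2 * p%:R * t%:R * (t%:R + 1)).
  elim: t => [|t IH]; first by rewrite big_ord0; ring.
  rewrite big_ord_recr /= IH /Y /tail_dlog dvdn_mull // andbT ifT; last first.
    by rewrite /bump; nia.
  by rewrite /bump /= add1n !natrM -!natr1; ring.
by rewrite ls -[(2 * s).+1]addn1 natrM natrD natrM; ring.
Qed.

End Doubling.

(** * Peeling off the exponential factors *)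

Section Factorization.
Variables (K : fieldType) (V : lmodType K).
Hypothesis charK : [pchar K] =i pred0.
Variable T : nat -> nat -> {linear V -> V}.
Hypothesis T0 : forall d x, T 0 d x = d%:R *: x.
Hypothesis TT : forall m n d x,
  T m (n + d) (T n d x) - T n (m + d) (T m d x) = (n%:R - m%:R) *: T (m + n) d x.
Local Notation W := (nat -> V).
Implicit Types psi : W.

Lemma opDl (a b : nat -> K) psi :
  op T (fun n => a n + b n) psi = op T a psi + op T b psi.
Proof.
apply/funext => h; rewrite fctE /op -big_split.
by apply: eq_bigr => i _; rewrite scalerDl.
Qed.

Lemma opZl (c : K) (a : nat -> K) psi :
  op T (fun n => c * a n) psi = c *: op T a psi.
Proof.
apply/funext => h; rewrite fctE /op scaler_sumr.
by apply: eq_bigr => i _; rewrite scalerA.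
Qed.

Lemma op_lead (a : nat -> K) psi p h : (p <= h)%N ->
  (forall i, (i < p)%N -> a i = 0) -> (forall k, (k + p < h)%N -> psi k = 0) ->
  op T a psi h = a p *: T p (h - p) (psi (h - p)%N).
Proof.
move=> ph ap psih; have lt_p : (p < h.+1)%N by [].
rewrite /op (bigD1 (Ordinal lt_p)) //= big1 ?addr0 // => i.
rewrite -val_eqE /= => ip; have [lt_ip|le_pi] := ltnP i p.
  by rewrite ap ?scale0r.
by rewrite psih ?linear0 ?scaler0 //; have := ltn_ord i; lia.
Qed.

Lemma op_below (a : nat -> K) psi n h :
  (forall i, (i < n)%N -> a i = 0) -> (h < n)%N -> op T a psi h = 0.
Proof. by move=> an hn; apply: (@op_order _ _ T a psi n 0); rewrite ?addn0. Qed.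

Lemma degree_pulse p psi :
  degree (op T (pulse 1 p) psi) =
  op T (pulse 1 p) (degree psi) + p%:R *: op T (pulse 1 p) psi.
Proof.
rewrite degree_op // -opZl; congr (_ + op T _ _); apply/funext => n.
by rewrite /weuler /pulse; case: eqP => [->|]; rewrite ?mulr0.
Qed.

(** The difference [R] of the two sides satisfies [D R = p R + Y R + R D], so [degree_vanish]
    applies with shift [c = p]. *)
Lemma exp_op_intertwine q p psi : (0 < p)%N -> q 0%N = 0 ->
  dlog q = tail_dlog K (2 * p) ->
  exp_op T q (op T (pulse 1 p) psi) = op T (odd_multiples K p) (exp_op T q psi).
Proof.
move=> p0 q0 dq; set Y := tail_dlog _ _ in dq; set Z := odd_multiples _ _.
have Z_order i : (i < p)%N -> Z i = 0.
  by move=> ip; rewrite /Z /odd_multiples divn_small ?andbF.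
have pulse_lt i : (i < p)%N -> pulse (1 : K) p i = 0.
  by move=> ip; rewrite /pulse ifF //; lia.
apply/eqP; rewrite -subr_eq0; apply/eqP/funext => h.
pose R : {linear W -> W} :=
  ((exp_op T q \o op T (pulse 1 p)) \- (op T Z \o exp_op T q)).
apply: (@degree_vanish _ _ T charK R Y p h.+1) => // {}psi k.
  (* Order condition: both sides have the same leading term [T p], because [Z p = 1] and
     [exp_op T q] fixes lowest components. *)
  move=> psi0.
  have psi1 i : (i < k - p)%N -> psi i = 0 by move=> ik; rewrite psi0 //; lia.
  have Epsi0 i : (i < k - p)%N -> exp_op T q psi i = 0.
    by move=> ik; rewrite exp_op_lead ?psi1 // => j ji; rewrite psi1 //; lia.
  have MM0 i : (i < p + (k - p))%N -> op T (pulse 1 p) psi i = 0.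
    exact: op_order.
  rewrite /R /= !fctE (exp_op_lead _ q0) => [|i ik]; last by rewrite MM0 //; lia.
  have [kp|pk] := ltnP k p.
    by rewrite (op_below _ pulse_lt) // (op_below _ Z_order) // subrr.
  rewrite !(@op_lead _ _ p) // => [|i ip]; last by rewrite Epsi0 //; lia.
  rewrite (exp_op_lead _ q0) // /pulse eqxx /Z /odd_multiples dvdnn divnn p0.
  by rewrite subrr.
move=> _.
suff -> : degree (R psi) = p%:R *: R psi + op T Y (R psi) + R (degree psi) by [].
have key phi : op T (weuler Z) phi =
    p%:R *: op T Z phi + (op T Y (op T Z phi) - op T Z (op T Y phi)).
  rewrite op_bracket // -opZl -opDl; congr (op _ _ _).
  by apply/funext => l; rewrite /weuler odd_multiples_bracket.
rewrite /R /= [degree _]linearB /=.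
rewrite degree_exp // dq degree_pulse [in LHS]linearD /= linearZ /=.
rewrite degree_op // key degree_exp // dq opD scalerBr [op T Y (_ - _)]linearB /=.
rewrite [X in _ - X = _](AC (2*(1*2)) ((1*5)*2*3*4)) /= subrr add0r !opprD.
by rewrite (AC ((1*2)*3) (((3*5)*(1*6))*(2*4))).
Qed.

(** Moving [pulse] past [exp_op T q'] turns it into [odd_multiples], so both sides have logarithmic
    derivative [dlog q]; [degree_vanish] applies with [c = 0]. *)
Lemma exp_op_factor q c p : (0 < p)%N -> q 0%N = 0 ->
  dlog q = (fun n => p%:R * c * odd_multiples K p n + tail_dlog K (2 * p) n) ->
  exists2 q', q' 0%N = 0 /\ dlog q' = tail_dlog K (2 * p) &
    forall psi, exp_op T q psi = exp_op T q' (exp_op T (pulse c p) psi).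
Proof.
move=> p0 q0 dq.
have [//|q' q'0 dq'] := @vfield_dlog_exists K charK (tail_dlog K (2 * p)).
exists q' => // psi; apply/eqP; rewrite -subr_eq0; apply/eqP/funext => h.
have pulse0 : pulse c p 0 = 0 by rewrite /pulse ifF //; lia.
pose R : {linear W -> W} := exp_op T q \- (exp_op T q' \o exp_op T (pulse c p)).
apply: (@degree_vanish _ _ T charK R (dlog q) 0 h.+1) => // [|{}psi k|{}psi k].
- exact: dlog0.
- move=> psi0; have {}psi0 i : (i < k)%N -> psi i = 0.
    by move=> ik; rewrite psi0 ?addn0.
  rewrite /R /= !fctE !exp_op_lead ?subrr // => i ik.
  by rewrite exp_op_lead ?psi0 // => j ji; rewrite psi0 // (ltn_trans ji).
move=> _; rewrite scale0r add0r.
suff -> : degree (R psi) = op T (dlog q) (R psi) + R (degree psi) by [].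
rewrite /R /= [degree _]linearB /= !degree_exp // dq' dlog_pulse //.
rewrite [exp_op T q' (_ + _)]linearD /= [op T (dlog q) (_ - _)]linearB /=.
have -> : pulse (p%:R * c) p = (fun n => p%:R * c * pulse 1 p n).
  by apply/funext => n; rewrite /pulse; case: eqP; rewrite ?mulr1 ?mulr0.
rewrite opZl [exp_op T q' (_ *: _)]linearZ /= exp_op_intertwine // -opZl.
have -> phi : op T (dlog q) (exp_op T q' phi) =
    op T (fun n => p%:R * c * odd_multiples K p n) (exp_op T q' phi) +
    op T (tail_dlog K (2 * p)) (exp_op T q' phi) by rewrite dq opDl.
rewrite !opprD.
by rewrite (AC (2*(1*(1*1))) ((1*(4*3))*(2*5))).
Qed.

Definition ordered_product N psi : W :=
  foldl (fun phi n => exp_op T (pulse (- (2 / 2 ^+ n)) (2 ^ n)) phi)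
        (exp_op T (pulse 1 2) psi) (index_iota 2 N.+1).

(** The field [2 z^3 / (1 + z^2)], split as [exp_op_factor] requires with [p = 2] and [c = 1]. *)
Definition identity_dlog : nat -> K :=
  fun n => 2 * odd_multiples K 2 n + tail_dlog K 4 n.

Theorem exp_op_identity v N psi h : v 0%N = 0 -> dlog v = identity_dlog ->
  (0 < N)%N -> (h < 2 ^ N.+1)%N -> exp_op T v psi h = ordered_product N psi h.
Proof.
move=> v0 dv N0 hN.
have [q [q0 dq] ->] : exists2 q, q 0%N = 0 /\ dlog q = tail_dlog K (2 ^ N.+1) &
    exp_op T v psi = exp_op T q (ordered_product N psi).
  elim: N N0 {hN} => [//|[|N] IH] _.
    have [||//|q Hq Eq] := @exp_op_factor v 1 2; rewrite ?mulr1 //.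
    by exists q => //; rewrite Eq.
  have [//|q [q0 dq] ->] := IH.
  have p0 : (0 < 2 ^ N.+2)%N by rewrite expn_gt0.
  (* This [c] gives [p c = -2], the coefficient in [tail_dlog_split]. *)
  have [|q' Hq' Eq'] := @exp_op_factor q (- (2 / 2 ^+ N.+2)) (2 ^ N.+2) p0 q0.
    rewrite dq tail_dlog_split // natrX mulrN mulrCA mulfV ?mulr1 //.
    by rewrite expf_neq0 // natr_neq0.
  exists q'; first by rewrite expnS.
  have iotaE : index_iota 2 N.+3 = rcons (index_iota 2 N.+2) N.+2.
    by rewrite /index_iota !subSS !subn0 -[in LHS](addn1 N) iotaD cats1.
  by rewrite Eq' /ordered_product iotaE foldl_rcons.
(* The remaining factor has a logarithmic derivative starting in degree [2^(N+1)], so it is the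
   identity below that degree. *)
pose R : {linear W -> W} := exp_op T q \- idfun.
apply/eqP; rewrite -subr_eq0; apply/eqP.
apply: (@degree_vanish _ _ T charK R (fun=> 0) 0 (2 ^ N.+1)) => // {}psi k.
  move=> psi0; rewrite /R /= !fctE exp_op_lead ?subrr // => i ik.
  by rewrite psi0 // addn0.
move=> kN; rewrite /R /= [degree _]linearB /= degree_exp // dq scale0r add0r.
rewrite !fctE (@op_below _ _ (2 ^ N.+1)) //; last first.
  move=> i iN; rewrite /tail_dlog; case: ifP => // /andP[i0 /dvdn_leq].
  by rewrite i0 => /(_ isT); lia.
by rewrite /op big1 ?add0r // => i _; rewrite scale0r.
Qed.

End Factorization.

(** * The logarithmic derivative for [z / (1 - z^2)] *)

Lemma dlog_fps_identity (K : fieldType) (v : nat -> K) :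
  [pchar K] =i pred0 -> v 0%N = 0 -> exp_vfield v =1 fps_identity K ->
  dlog v = identity_dlog K.
Proof.
move=> charK v0 Hv; set y := identity_dlog K.
have y0 : y 0%N = 0.
  by rewrite /y /identity_dlog /odd_multiples /tail_dlog /= mulr0 addr0.
have y1 : y 1%N = 0.
  by rewrite /y /identity_dlog /odd_multiples /tail_dlog /= mulr0 addr0.
have y2 : y 2%N = 2.
  by rewrite /y /identity_dlog /odd_multiples /tail_dlog /= mulr1 addr0.
have ySS i : (0 < i)%N -> y i.+2 = - y i.
  move=> i0; rewrite /y /identity_dlog /odd_multiples /tail_dlog i0 /=.
  rewrite -[i.+2]addn2 dvdn_addl // divnDr // oddD addbT.
  have [/dvdnP[m im]|i2] := boolP (2 %| i)%N; last first.
    have i4 k : (2 %| k)%N -> (4 %| i + k)%N = false.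
      move=> k2; apply: contraNF i2 => i4.
      by rewrite -(dvdn_addl _ k2) (dvdn_trans _ i4).
    by rewrite i4 // -[i]addn0 i4 //= mulr0 addr0 oppr0.
  have d4 k : (4 %| k * 2)%N = ~~ odd k by rewrite -dvdn2 -(@dvdn_pmul2r 2 2 k).
  rewrite im mulnK // (_ : m * 2 + 2 = m.+1 * 2)%N ?d4; last by lia.
  by rewrite /=; case: (odd m); rewrite /= ?mulr0 ?mulr1 ?addr0 ?add0r ?opprK //.
apply: (vfield_dlog charK v0 Hv) => // h; rewrite op_fpsE /fps_identity.
(* Consecutive values of [h] are paired: by [ySS] the sum for [h + 2] is [2 h] (for odd [h], else 0)
   minus the sum for [h]. *)
suff [-> _] : \sum_(i < h.+1) y i * ((h - i)%:R * (odd (h - i))%:R)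
       = (h%:R - 1) * (odd h)%:R /\
     \sum_(i < h.+2) y i * ((h.+1 - i)%:R * (odd (h.+1 - i))%:R)
       = (h.+1%:R - 1) * (odd h.+1)%:R.
  by rewrite mulrBl mul1r addrC subrK.
elim: h => [|h [IH IH1]].
  rewrite !big_ord_recl !big_ord0 y0 /= !mul0r mulr0 !addr0 subrr mul0r.
  by rewrite mulr0.
split=> //; rewrite 2!big_ord_recl y0 mul0r add0r [y _]y1 mul0r add0r.
rewrite big_ord_recl [y _]y2 /= /bump /= !add1n !subSS subn0 negbK.
move: IH; rewrite big_ord_recl y0 mul0r add0r /= => IH.
rewrite (eq_bigr (fun i : 'I_h =>
  - (y i.+1 * ((h - i.+1)%:R * (odd (h - i.+1))%:R)))).
  rewrite sumrN; under eq_bigr do rewrite -[_.+1]/(bump 0 _).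
  by rewrite IH -[h.+2]addn2 natrD; ring.
by move=> i _; rewrite !add1n !subSS ySS // mulNr.
Qed.

(** * Exponentials of linear series and BPZ conjugation *)

Section Letters.
Variable K : fieldType.
Implicit Types (A B C : vseries K) (w : seq int).

Definition is_letters A := forall w, size w != 1%N -> A w = 0.

Lemma mul_letters_nil A B : is_letters A -> vs_mul A B [::] = 0.
Proof. by move=> HA; rewrite /vs_mul big_ord1 /= HA ?mul0r. Qed.

Lemma mul_letters_cons A B x w : is_letters A ->
  vs_mul A B (x :: w) = A [:: x] * B w.
Proof.
move=> HA; rewrite /vs_mul 2!big_ord_recl /= HA // mul0r add0r take0 drop0.
rewrite big1 ?addr0 // => i _; rewrite HA ?mul0r //= size_take.
by have : (i < size w)%N := ltn_ord i; rewrite /bump; case: ifP; lia.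
Qed.

Lemma mul_lettersA A B C : is_letters A ->
  vs_mul (vs_mul A C) B = vs_mul A (vs_mul C B).
Proof.
move=> HA; apply/funext => -[|x w].
  by rewrite [RHS]mul_letters_nil // {1}/vs_mul big_ord1 /= mul_letters_nil ?mul0r.
rewrite [RHS]mul_letters_cons // {1}/vs_mul big_ord_recl /= mul_letters_nil //.
rewrite mul0r add0r mulr_sumr; apply: eq_bigr => i _ /=.
by rewrite mul_letters_cons // mulrA.
Qed.

Lemma mul_one B : vs_mul (@vs_one K) B = B.
Proof.
apply/funext => w; rewrite /vs_mul big_ord_recl /= take0 drop0 /vs_one mul1r.
rewrite big1 ?addr0 // => i _; rewrite -size_eq0 size_take /= /bump /=.
by rewrite (_ : _ == _ = false) ?mul0r //; have := ltn_ord i; case: ifP; lia.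
Qed.

Lemma iter_letters_one A B j : is_letters A ->
  vs_mul (iter j (vs_mul A) (@vs_one K)) B = iter j (vs_mul A) B.
Proof.
by move=> HA; elim: j => [|j IH]; rewrite ?mul_one // !iterS mul_lettersA // IH.
Qed.

Lemma iter_letters_size A B j w : is_letters A -> (size w < j)%N ->
  iter j (vs_mul A) B w = 0.
Proof.
move=> HA; elim: j w => [//|j IH] [|x w] /= szw; first by rewrite mul_letters_nil.
by rewrite mul_letters_cons // IH ?mulr0.
Qed.

(** Turns a left factor [exp A] into iterated left multiplication by [A], the shape of [exp_op]. *)
Lemma mul_expE A B w J : is_letters A -> (size w < J)%N ->
  vs_mul (vs_exp A) B w =
  \sum_(j < J) (j`!)%:R^-1 * iter j (vs_mul A) B w.
Proof.
move=> HA szw.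
have expE u : (size u < J)%N -> vs_exp A u =
    \sum_(j < J) (j`!)%:R^-1 * iter j (vs_mul A) (@vs_one K) u.
  move=> uJ; rewrite /vs_exp.
  rewrite (big_ord_widen J (fun j =>
    (j`!)%:R^-1 * iter j (vs_mul A) (@vs_one K) u)) //.
  rewrite big_mkcond /=; apply: eq_bigr => j _; case: ifP => // uj.
  by rewrite iter_letters_size ?mulr0 //; lia.
rewrite {1}/vs_mul.
under eq_bigr => i _.
  rewrite expE; last by rewrite (leq_ltn_trans _ szw) // size_take; case: ifP; lia.
  rewrite mulr_suml; over.
rewrite exchange_big; apply: eq_bigr => j _.
rewrite -(iter_letters_one B j HA) mulr_sumr.
by apply: eq_bigr => i _; rewrite mulrA.
Qed.

Lemma iter_letters_oneE A j w : is_letters A ->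
  iter j (vs_mul A) (@vs_one K) w =
  if size w == j then \prod_(n <- w) A [:: n] else 0.
Proof.
move=> HA; elim: j w => [|j IH] [|x w] /=.
- by rewrite big_nil.
- by [].
- by rewrite mul_letters_nil.
- by rewrite mul_letters_cons // IH eqSS big_cons; case: ifP => //; rewrite mulr0.
Qed.

(** The BPZ image of [vs_pos a]: [Negz n] is [-(n+1)]. *)
Definition vs_neg (a : nat -> K) : vseries K :=
  fun w => if w is [:: Negz n] then (-1) ^+ n.+1 * a n.+1 else 0.

Lemma vs_neg_letters a : is_letters (vs_neg a).
Proof. by move=> [|[n|n] [|x w]]. Qed.

Lemma vs_pos_letters a : is_letters (vs_pos a).
Proof. by move=> [|[[|n]|n] [|x w]]. Qed.

(** Coefficients of a power of a linear series are products over the letters, hence invariant under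
    reversal of the word; only the change of letters and signs remains. *)
Lemma bpz_U_op (v : nat -> K) : bpz (U_op v) = vs_exp (vs_neg v).
Proof.
apply/funext => w; rewrite /bpz /U_op /vs_exp size_rev size_map mulr_sumr.
apply: eq_bigr => j _; rewrite mulrCA; congr (_ * _).
rewrite !iter_letters_oneE; [|exact: vs_neg_letters|exact: vs_pos_letters].
rewrite size_rev size_map; case: ifP => _; last by rewrite mulr0.
rewrite (perm_big _ (permEl (perm_rev _))) /= big_map -big_split /=.
apply: eq_bigr => -[[|n]|n] _; rewrite ?mulr0 //.
by rewrite NegzE opprK /= -exprnN -exprVn invrN1.
Qed.

Lemma vs_L_neg (c : K) (p : nat) : (0 < p)%N -> ~~ odd p ->
  vs_L c (- p%:Z) = vs_neg (pulse c p).
Proof.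
case: p => // p _ evp; apply/funext => w; rewrite /vs_L /vs_neg -NegzE.
case: w => [|[n|n] [|x w]] //=.
  rewrite /pulse !eqseq_cons andbT eqSS.
  rewrite (_ : (Negz n == Negz p) = (n == p)) //.
  case: eqP => [->|]; last by rewrite mulr0.
  by rewrite -signr_odd (negPf evp) mul1r.
by rewrite eqseq_cons andbF.
Qed.

End Letters.

(** * Enumeration of words in negative letters *)

(** [m] is fuel bounding the length; [m >= h] is enough, since each letter lowers the sum by at
    least 1. *)
Fixpoint neg_words (m h : nat) : seq (seq int) :=
  match h, m with
  | 0, _ => [:: [::]]
  | h'.+1, m'.+1 => [seq Negz i :: w | i <- iota 0 h, w <- neg_words m' (h' - i)]
  | _, 0 => [::]
  end%N.

Local Notation neg := (fun n : int => n < 0).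

Lemma size_neg_words (w : seq int) :
  all neg w -> ((size w)%:Z <= - (\sum_(n <- w) n))%R.
Proof.
elim: w => [|x w IH] /=; first by rewrite big_nil.
by case/andP=> x0 /IH; rewrite big_cons; move: (\sum_(n <- w) n : int) => S; lia.
Qed.

Lemma mem_neg_words m h (w : seq int) : (h <= m)%N ->
  (w \in neg_words m h) = all neg w && (- (\sum_(n <- w) n) == h%:Z).
Proof.
elim: m h w => [|m IH] h w hm.
  have -> : h = 0%N by lia.
  case: w => [|x w]; first by rewrite big_nil.
  rewrite inE /=; symmetry; apply/negP.
  move=> /andP[/(@size_neg_words (x :: w)) szw /eqP hw].
  by rewrite hw in szw.
case: h hm => [|h] hm.
  case: w => [|x w]; first by rewrite big_nil.
  rewrite inE /=; symmetry; apply/negP.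
  move=> /andP[/(@size_neg_words (x :: w)) szw /eqP hw].
  by rewrite hw in szw.
apply/allpairsPdep/andP => [[i [u [ih uh ->]]]|[]].
  move: ih uh; rewrite mem_iota IH; last by lia.
  move=> ih /andP[negu /eqP hu]; split; first by rewrite /= negu.
  by rewrite big_cons; move: hu; move: (\sum_(n <- u) n : int) => S; lia.
case: w => [|[n|n] u] //=; first by rewrite big_nil.
move=> negu; rewrite big_cons => /eqP hu; exists n, u.
have szu := size_neg_words negu.
move: hu; rewrite -[0%N :: _]/(iota 0 h.+1) mem_iota.
have IHn := IH (h - n)%N u; rewrite IHn ?negu; last by lia.
move=> hu; move: (\sum_(n <- u) n : int) szu hu => S szu hu.
by rewrite NegzE in hu; split=> //; clear IH IHn; lia.
Qed.

Lemma uniq_neg_words m h : uniq (neg_words m h).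
Proof.
elim: m h => [|m IH] [|h] //=.
apply: (@allpairs_uniq_dep _ (fun=> seq int) _
  (fun i w => Negz i :: w) (iota 0 h.+1)).
- exact: iota_uniq.
- by move=> i _.
by move=> [i u] [j w] _ _ /= [-> ->].
Qed.

(** * Kets as elements of a graded module *)

Section Kets.
Variables (K : fieldType) (V : lmodType K) (L : int -> {linear V -> V}) (vac : V).

(* The index 0 is the degree operator instead of [L 0]: [V] need not be graded. *)
Definition bpz_action (n d : nat) : {linear V -> V} :=
  if n is 0%N then *:%R (d%:R : K) else *:%R ((-1) ^+ n : K) \o L (- n%:Z).

Lemma bpz_action_witt (HL : virasoro_c0 L) m n d x :
  bpz_action m (n + d) (bpz_action n d x) - bpz_action n (m + d) (bpz_action m d x)
  = (n%:R - m%:R) *: bpz_action (m + n) d x.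
Proof.
case: m n => [|m] [|n].
- by rewrite !subrr scale0r.
- rewrite subr0 /= [L _ (_ *: _)]linearZ /= !add0n !scalerA -scalerBl.
  by congr (_ *: _); move: ((-1) ^+ n.+1) => s; rewrite natrD; ring.
- rewrite addn0 sub0r /= [L _ (_ *: _)]linearZ /= !scalerA -scalerBl.
  by congr (_ *: _); move: ((-1) ^+ m.+1) => s; rewrite natrD; ring.
have LZ k c y : L k (c *: y) = c *: L k y by exact: linearZ.
rewrite addSn /= !LZ !scalerA (mulrC ((-1) ^+ n.+1)) -scalerBr HL scalerA.
rewrite -exprD addSn mulrC; congr ((_ * _) *: L _ x); last by lia.
by rewrite opprK addrC rmorphB.
Qed.

(** [m] stays free because removing a first letter in [ket_mul_neg] leaves [h - i] with fuel [h]. *)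
Lemma ketE (A : vseries K) (m h : nat) : on_words neg A -> (h <= m)%N ->
  ket L vac A h%:Z = \sum_(w <- neg_words m h) A w *: word_act L w vac.
Proof.
move=> An hm; rewrite fsbig_seq ?uniq_neg_words // /ket; symmetry.
apply: fsbig_widen => w /=.
  by rewrite mem_neg_words // => /andP[_ /eqP].
rewrite mem_neg_words // => -[-> /negP]; rewrite eqxx andbT => nw.
have [->|/An] := eqVneq (A w) 0; first by rewrite scale0r.
by rewrite (negPf nw).
Qed.

Lemma ket_lt0 (A : vseries K) (h : int) : on_words neg A -> h < 0 ->
  ket L vac A h = 0.
Proof.
move=> An h0; apply: fsbig1 => w /= hw.
have [->|/An /size_neg_words] := eqVneq (A w) 0; first by rewrite scale0r.
by rewrite hw; lia.
Qed.

Definition nat_ket (A : vseries K) : nat -> V := fun h => ket L vac A h%:Z.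

Lemma on_words_neg (a : nat -> K) : on_words neg (vs_neg a).
Proof. by move=> [|[n|n] [|x w]] //=; rewrite eqxx. Qed.

(** Words are grouped by their first letter, [Negz i] giving the term [i + 1] of [op]. *)
Lemma ket_mul_neg (a : nat -> K) (B : vseries K) : a 0%N = 0 -> on_words neg B ->
  nat_ket (vs_mul (vs_neg a) B) = op bpz_action a (nat_ket B).
Proof.
move=> a0 Bn; have An := on_words_mul (@on_words_neg a) Bn.
have letA := vs_neg_letters a.
apply/funext => -[|h]; rewrite /nat_ket (@ketE _ _ _ An (leqnn _)).
  by rewrite big_seq1 mul_letters_nil // scale0r /op big_ord1 a0 scale0r.
rewrite [neg_words _ _]/= (@big_allpairs_dep _ _ _ _ _ _
  (fun i w => Negz i :: w) (iota 0 h.+1) (fun i => neg_words h (h - i))).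
rewrite -[iota 0 h.+1]/(index_iota 0 h.+1) big_mkord.
rewrite /op [RHS]big_ord_recl a0 scale0r add0r; apply: eq_bigr => i _.
rewrite /nat_ket /= -[bump 0 i]/(i.+1) subSS -NegzE (@ketE B h) ?leq_subr //.
rewrite linear_sum !scaler_sumr.
apply: eq_bigr => w _; rewrite mul_letters_cons // [L _ (_ *: _)]linearZ /= !scalerA.
by rewrite (mulrC (a _)).
Qed.

Lemma on_words_iter (a : nat -> K) (B : vseries K) j :
  on_words neg B -> on_words neg (iter j (vs_mul (vs_neg a)) B).
Proof.
by move=> Bn; elim: j => //= j IH; apply: on_words_mul => //; apply: on_words_neg.
Qed.

(** Words contributing in degree [h] have at most [h] letters, so both exponentials can be cut off
    at [j = h]. *)
Lemma ket_exp_neg (a : nat -> K) (B : vseries K) : a 0%N = 0 -> on_words neg B ->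
  nat_ket (vs_mul (vs_exp (vs_neg a)) B) = exp_op bpz_action a (nat_ket B).
Proof.
move=> a0 Bn; have letA := vs_neg_letters a.
have An : on_words neg (vs_mul (vs_exp (vs_neg a)) B).
  by apply: on_words_mul => //; apply/on_words_exp/on_words_neg.
apply/funext => h; rewrite {1}/nat_ket (@ketE _ _ _ An (leqnn _)).
have iterE j : iter j (op bpz_action a) (nat_ket B) =
    nat_ket (iter j (vs_mul (vs_neg a)) B).
  by elim: j => //= j ->; rewrite ket_mul_neg //; apply: on_words_iter.
rewrite big_seq; under eq_bigr => w.
  rewrite mem_neg_words // => /andP[/size_neg_words szw /eqP hw].
  rewrite (@mul_expE _ _ _ _ h.+1) //; last by rewrite hw in szw; lia.
  rewrite scaler_suml; over.
rewrite -big_seq exchange_big; apply: eq_bigr => j _.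
rewrite iterE /nat_ket (@ketE _ _ _ (@on_words_iter a _ j Bn) (leqnn h)) scaler_sumr.
by apply: eq_bigr => w _; rewrite scalerA.
Qed.

Lemma vs_exp_mul_one (a : nat -> K) :
  vs_exp (vs_neg a) = vs_mul (vs_exp (vs_neg a)) (@vs_one K).
Proof.
by apply/funext => w; rewrite (mul_expE _ (vs_neg_letters a) (ltnSn _)).
Qed.

Lemma on_words_one : on_words neg (@vs_one K).
Proof. by case=> // x w; rewrite /vs_one /= eqxx. Qed.

Lemma ket_identity_product N :
  nat_ket (identity_product K N) =
  ordered_product bpz_action N (nat_ket (@vs_one K)).
Proof.
rewrite /identity_product /ordered_product.
(* The index [2^n] is even for [n > 0], so BPZ conjugation contributes no sign. *)
have expL c n : (0 < n)%N ->
    vs_exp (vs_L c (- (2 ^ n)%N%:Z)) = vs_exp (vs_neg (pulse c (2 ^ n))) :> vseries K.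
  by case: n => // n _; rewrite vs_L_neg ?expn_gt0 // oddX.
have pulse0 c n : pulse c (2 ^ n) 0 = 0 :> K.
  by rewrite /pulse ifF //; apply/negP => /eqP n0; have := expn_gt0 2 n; rewrite -n0.
have := @on_words_exp K _ _ (@on_words_neg (pulse 1 (2 ^ 1))).
rewrite (expL 1 1%N) //.
have : nat_ket (vs_exp (vs_neg (pulse 1 (2 ^ 1)))) =
    exp_op bpz_action (pulse 1 2) (nat_ket (@vs_one K)).
  by rewrite vs_exp_mul_one ket_exp_neg //; apply: on_words_one.
have : all (fun n => 0 < n)%N (index_iota 2 N.+1).
  by apply/allP => n; rewrite mem_index_iota; lia.
elim: (index_iota _ _) (vs_exp _) (exp_op _ _ _) => [|n s IH] B phi //=.
move=> /andP[n0 s0] <- Bn; apply: IH => //.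
  by rewrite expL // ket_exp_neg.
by rewrite expL //; apply: on_words_mul => //; apply/on_words_exp/on_words_neg.
Qed.

End Kets.

Theorem mainTheorem2 (K : fieldType) (charK : [pchar K] =i pred0)
    (V : lmodType K) (L : int -> {linear V -> V}) (vac : V)
    (HL : virasoro_c0 L) (Hvac : sl2_vacuum L vac)
    (v : nat -> K) (Hv : exp_vfield v =1 fps_identity K) :
  formal_cvg (fun N => ket L vac (identity_product K N))
             (ket L vac (bpz (U_op v))).
Proof.
(* Setting the value at 0 to 0 changes neither [vfield v] nor [vs_neg v] and makes the lemmas on
   [exp_op] applicable. *)
pose v' n := if n == 0%N then 0 else v n.
have v'f : exp_vfield v' =1 fps_identity K.
  have eqv : vfield v' = vfield v by apply/funext => -[|[|n]].
  by move=> h; rewrite -Hv /exp_vfield /vderiv eqv.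
have dv' := dlog_fps_identity charK (erefl : v' 0%N = 0) v'f.
case=> [h|h]; last first.
  exists 0%N => N _; rewrite !ket_lt0 //; first exact: on_words_bpz_U.
  exact: on_words_identity_product.
(* This bound makes [N] positive and ensures [h < 2^(N+1)]. *)
exists h.+1 => N hN.
rewrite -[LHS]/(nat_ket L vac _ h) -[RHS]/(nat_ket L vac _ h).
rewrite ket_identity_product bpz_U_op.
have -> : vs_neg v = vs_neg v' by apply/funext => -[|[n|n] [|x w]].
rewrite vs_exp_mul_one ket_exp_neg //; last exact: on_words_one.
symmetry; apply: (exp_op_identity charK) => //.
- exact: bpz_action_witt.
- by lia.
- by apply: leq_trans (ltn_expl N.+1 (ltnSn 1)); lia.
Qed.
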